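(* For every integer $m\ge1$, $$\operatorname{ex}_2^+(m,TT_3)=m\left\lfloor\frac{m^2}{4}\right\rfloor.$$ Moreover, a $TT_3$-free digraph $D$ on $m$ vertices satisfies $\sum_{v\in V(D)}d_D^+(v)^2=m\lfloor m^2/4\rfloor$ if and only if $D$ is (isomorphic to) the complete bipartite digraph with part sizes $\lfloor m/2\rfloor$ and $\lceil m/2\rceil$.
   Context: Digraphs are finite and loopless; digons (pairs of opposite arcs on the same two vertices) are allowed. $TT_3$ is the transitive tournament on three vertices. A digraph is $F$-free if it contains no (not necessarily induced) subdigraph isomorphic to $F$. With $d_D^+(v)$ the out-degree, $$\operatorname{ex}_2^+(m,F)=\max\Big\{\sum_{v\in V(D)}d_D^+(v)^2 : |V(D)|=m,\ D\text{ is }F\text{-free}\Big\}.$$ The complete bipartite digraph with parts $A,B$ has both arcs $ab$ and $ba$ for every $a\in A$, $b\in B$, and no arcs inside $A$ or inside $B$. *)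

(* Defs.v *)
From HB Require Import structures.
From mathcomp Require Import all_boot.
Set Implicit Arguments.
Unset Strict Implicit.
Unset Printing Implicit Defensive.

(* Both (u, v) and (v, u) may belong to [arcs D], i.e. digons are allowed. *)
Record digraph (V : finType) := Digraph {
  arcs : {set V * V};
  _ : [forall v, (v, v) \notin arcs] }.

HB.instance Definition _ (V : finType) := [isSub for @arcs V].
HB.instance Definition _ (V : finType) := [Finite of digraph V by <:].

Definition adj (V : finType) (D : digraph V) : rel V :=
  fun u v => (u, v) \in arcs D.

Lemma rel_arcs_loopless (V : finType) (r : rel V) :
  irreflexive r -> [forall v, (v, v) \notin [set p | r p.1 p.2]].
Proof. by move=> r_irr; apply/forallP=> v; rewrite inE /= r_irr. Qed.

Definition digraph_of_rel (V : finType) (r : rel V) (r_irr : irreflexive r) :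
  digraph V := Digraph (rel_arcs_loopless r_irr).

Definition outdeg (V : finType) (D : digraph V) (v : V) : nat :=
  #|[set w | adj D v w]|.

Definition sum_outdeg_sq (V : finType) (D : digraph V) : nat :=
  \sum_(v : V) outdeg D v ^ 2.

(* Only the arcs of [F] have to be preserved: the copy need not be induced. *)
Definition contains (U V : finType) (F : digraph U) (D : digraph V) : bool :=
  [exists f : {ffun U -> V}, injectiveb f &&
    [forall x, forall y, adj F x y ==> adj D (f x) (f y)]].

Definition free (U V : finType) (F : digraph U) (D : digraph V) : bool :=
  ~~ contains F D.

Definition isomorphic (U V : finType) (D : digraph U) (E : digraph V) : Prop :=
  exists2 f : U -> V, bijective f &
    forall x y, adj D x y = adj E (f x) (f y).

(* Being F-free and the sum of squared out-degrees are invariant under         *)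
(* isomorphism, so it is enough to range over digraphs with vertex set 'I_m.   *)
(* The maximum over an empty family is 0; this does not occur when F has an    *)
(* arc, as the arcless digraph is then F-free.                                 *)
Definition ex2p (m : nat) (U : finType) (F : digraph U) : nat :=
  \max_(D : digraph 'I_m | free F D) sum_outdeg_sq D.

Definition TT3 : digraph 'I_3 :=
  digraph_of_rel (r := fun i j : 'I_3 => i < j) (fun i => ltnn i).

Definition bip_rel (A B : finType) : rel (A + B) := fun x y =>
  match x, y with
  | inl _, inr _ | inr _, inl _ => true
  | _, _ => false
  end.

Lemma bip_rel_irr (A B : finType) : irreflexive (@bip_rel A B).
Proof. by case. Qed.

Definition complete_bipartite (a b : nat) : digraph ('I_a + 'I_b)%type :=
  digraph_of_rel (@bip_rel_irr 'I_a 'I_b).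

(* Main.v *)
Require Import Defs.
From mathcomp Require Import all_boot.
From mathcomp Require Import zify.
Set Implicit Arguments.
Unset Strict Implicit.
Unset Printing Implicit Defensive.

(** If [u -> v] is an arc of a [TT3]-free digraph, the out-neighbourhoods of
    [u] and [v] are disjoint. Let [u] have the maximum out-degree [d], with
    out-neighbourhood [N]. The [d] vertices of [N] have out-degree at most
    [m - d] and the [m - d] others at most [d], so the sum of squares is at most
    [d (m - d)^2 + (m - d) d^2 = m d (m - d) <= m floor(m^2/4)]. In case of
    equality every vertex of [N] dominates the whole complement of [N]; hence
    the complement is independent, and each of its vertices dominates [N]. *)

Lemma half_mul_uphalf m : m./2 * uphalf m = m ^ 2 %/ 4.
Proof. by have := odd_double_half m; rewrite uphalf_half; case: odd; nia. Qed.

Lemma leq_mul_sqr_div4 a b : a * b <= (a + b) ^ 2 %/ 4.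
Proof. by rewrite leq_divRL // mulnC nat_AGM2. Qed.

(** The floor loses less than one unit, so equality gives [(a - b)^2 < 4]: the two numbers differ by
    at most one, and the smaller is the half of the sum. *)
Lemma mul_eq_sqr_div4 a b : a * b = (a + b) ^ 2 %/ 4 ->
  a = (a + b)./2 \/ b = (a + b)./2.
Proof.
move=> eq_ab; have : (a + b) ^ 2 < 4 * (a * b) + 4 by nia.
move=> lt_ab; have {eq_ab lt_ab} [] : a <= b + 1 /\ b <= a + 1 by nia.
lia.
Qed.

Section Digraph.

Variables (V : finType) (D : digraph V).
Implicit Types (u v w : V) (A : {set V}).

Local Notation outnbr v := [set w | adj D v w].

Lemma TT3_free_adj u v w :
  free TT3 D -> adj D u v -> adj D u w -> ~~ adj D v w.
Proof.
have noloop x : ~~ adj D x x by case: D => E E_loopless; apply: (forallP E_loopless).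
move=> freeD uv uw; apply: contra freeD => vw.
have [nuv nuw nvw] : [/\ u != v, u != w & v != w].
  by split; apply: contraTneq isT => eq_xy;
     move: uv uw vw; rewrite eq_xy ?(negPf (noloop _)).
(* The vertices 0, 1, 2 of [TT3] go to [u], [v], [w], distinct because there are no loops. The
   default [u] of [nth] is never reached. *)
apply/existsP; exists [ffun i : 'I_3 => nth u [:: u; v; w] i].
apply/andP; split.
  apply/injectiveP=> i j; rewrite !ffunE => /eqP.
  rewrite nth_uniq ?ltn_ord // => [/eqP/val_inj //|].
  by rewrite /= !inE negb_or nuv nuw nvw.
apply/forallP=> -[[|[|[|i]]] lti] //; apply/forallP=> -[[|[|[|j]]] ltj] //;
  by rewrite !ffunE /adj inE.
Qed.

(** This describes a complete bipartite digraph inside [V] by one of its sides, so that counting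
    needs no transport along an isomorphism. *)
Definition complete_cut A := forall x y, adj D x y = ((x \in A) != (y \in A)).

Lemma complete_cutC A : complete_cut A -> complete_cut (~: A).
Proof. by move=> cutA x y; rewrite cutA !inE; do 2!case: (_ \in A). Qed.

(** Pigeonhole: two of any three vertices lie on the same side, whereas any two vertices of [TT3]
    are joined by an arc. *)
Lemma complete_cut_free A : complete_cut A -> free TT3 D.
Proof.
move=> cutA; apply/existsP=> -[f /andP[_ /forallP arcf]].
have arc (i j : 'I_3) : i < j -> (f i \in A) != (f j \in A).
  move=> ltij; rewrite -cutA; move/forallP/(_ j)/implyP: (arcf i); apply.
  by rewrite /adj inE.
have := arc ord0 (inord 2); have := arc (inord 1) (inord 2).
have := arc ord0 (inord 1); rewrite !inordK // => /(_ isT) + /(_ isT) + /(_ isT).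
by do 3!case: (_ \in A).
Qed.

Lemma outdeg_complete_cut A v : complete_cut A ->
  outdeg D v = if v \in A then #|~: A| else #|A|.
Proof.
move=> cutA; rewrite /outdeg; case: ifP => vA; apply: eq_card => w;
  by rewrite !inE cutA vA //; case: (w \in A).
Qed.

Lemma sum_split_const (F : V -> nat) A a b :
    (forall v, F v = if v \in A then a else b) ->
  \sum_v F v = #|A| * a + #|~: A| * b.
Proof.
move=> FE; rewrite (bigID (mem A)) /=; congr (_ + _).
  by rewrite -sum_nat_const; apply: eq_bigr => v vA; rewrite FE vA.
rewrite -sum_nat_const; apply: eq_big => [v|v vA]; first by rewrite inE.
by rewrite FE (negPf vA).
Qed.

Lemma sum_outdeg_sq_complete_cut A : complete_cut A ->
  sum_outdeg_sq D = #|V| * (#|A| * #|~: A|).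
Proof.
move=> cutA; rewrite -(cardsC A).
rewrite /sum_outdeg_sq (@sum_split_const _ A (#|~: A| ^ 2) (#|A| ^ 2)); first nia.
by move=> v; rewrite (outdeg_complete_cut v cutA) (fun_if (expn^~ 2)).
Qed.

Lemma complete_cut_isomorphic A : complete_cut A ->
  isomorphic D (complete_bipartite #|A| #|~: A|).
Proof.
(* The inverse of the isomorphism is the easier map to write: it enumerates each side. Being
   injective between types of equal size, it is bijective. *)
move=> cutA; pose g (x : 'I_#|A| + 'I_#|~: A|) :=
  match x with inl i => enum_val i | inr j => enum_val j end.
have gA x : (g x \in A) = if x is inl _ then true else false.
  by case: x => i /=; have := enum_valP i; rewrite ?inE // => /negPf.
have g_inj : injective g.
  move=> x y eq_g; have := gA y; rewrite -eq_g gA.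
  by case: x y eq_g => i [j|j] //= /enum_val_inj ->.
have [f gK fK] : bijective g.
  by apply: inj_card_bij g_inj _; rewrite card_sum !card_ord cardsC.
exists f; first by exists g.
by move=> x y; rewrite -{1}[x]fK -{1}[y]fK cutA !gA /adj inE; case: (f x); case: (f y).
Qed.

Lemma isomorphic_complete_cut a b : isomorphic D (complete_bipartite a b) ->
  exists A, [/\ complete_cut A, #|A| = a & #|~: A| = b].
Proof.
case=> f [g fK gK] adjE.
pose A := [set x | if f x is inl _ then true else false].
have cardA : #|A| = a.
  have -> : A = [set g (inl i) | i : 'I_a].
    apply/setP=> x; rewrite inE; apply/idP/imsetP => [|[i _ ->]]; last by rewrite gK.
    by case fx: (f x) => [i|] // _; exists i; rewrite // -fx fK.
  by rewrite card_imset ?card_ord // => i j /(can_inj gK) [].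
exists A; split=> //.
  by move=> x y; rewrite adjE !inE /adj inE; case: (f x); case: (f y).
have := cardsC A; rewrite (bij_eq_card (Bijective fK gK)) card_sum !card_ord cardA.
exact: addnI.
Qed.

Section TT3Free.

Hypothesis freeD : free TT3 D.

Lemma TT3_free_subset u v : adj D u v -> outnbr v \subset ~: outnbr u.
Proof.
by move=> uv; apply/subsetP=> w; rewrite !inE; apply: contraL; apply: TT3_free_adj uv.
Qed.

Variables (u : V) (maxu : forall v, outdeg D v <= outdeg D u).

Local Notation N := (outnbr u).

Lemma TT3_free_outdeg_le v :
  outdeg D v <= if v \in N then #|~: N| else #|N|.
Proof.
case: ifP => [|_]; last exact: maxu.
by rewrite inE => /TT3_free_subset/subset_leq_card.
Qed.

(** The bound is a sum of termwise bounds, and squaring is strictly increasing, so equality of the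
    sums forces equality at every vertex. The form [leqif] keeps this equality case for the
    uniqueness part. *)
Lemma TT3_free_sum_leqif :
  sum_outdeg_sq D <= #|V| * (#|N| * #|~: N|) ?=
    iff [forall v, outdeg D v == if v \in N then #|~: N| else #|N|].
Proof.
pose F v := (if v \in N then #|~: N| else #|N|) ^ 2.
have -> : #|V| * (#|N| * #|~: N|) = \sum_v F v.
  rewrite -(cardsC N) (@sum_split_const _ N (#|~: N| ^ 2) (#|N| ^ 2)); first nia.
  by move=> v; rewrite /F (fun_if (expn^~ 2)).
apply: leqif_sum => v _; apply/leqifP; have := TT3_free_outdeg_le v; rewrite /F.
set c := (if v \in N then _ else _) => le_c.
case: eqnP => [->|/eqP ne_v]; first by rewrite eqxx.
by rewrite ltn_sqr ltn_neqAle ne_v.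
Qed.

Lemma TT3_free_extremal :
    (forall v, outdeg D v = if v \in N then #|~: N| else #|N|) ->
  complete_cut N.
Proof.
move=> degE.
have out_in v : v \in N -> outnbr v = ~: N.
  move=> vN; apply/eqP; rewrite eqEcard TT3_free_subset //=; last by rewrite inE in vN.
  by have := degE v; rewrite vN => <-.
have out_notin w : w \notin N -> outnbr w = N.
  move=> wN; have cardw : #|outnbr w| = #|N| by have := degE w; rewrite (negPf wN).
  apply/eqP; rewrite eqEcard cardw leqnn andbT.
  (* If [N] is empty, then [w] has out-degree 0. Otherwise some [v] in [N] dominates [w], and the
     out-neighbourhood of [w] avoids that of [v], which is [~: N]. *)
  have [N0|[v vN]] := set_0Vmem N.
    by rewrite N0 subset0 -cards_eq0 cardw N0 cards0.
  have vw : adj D v w by have := in_setC w N; rewrite -(out_in v vN) wN inE.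
  by have := TT3_free_subset vw; rewrite (out_in v vN) setCK.
move=> x y; have -> : adj D x y = (y \in outnbr x) by rewrite inE.
case: (boolP (x \in N)) => xN; last by rewrite (out_notin x xN); case: (y \in N).
by rewrite (out_in x xN) in_setC; case: (y \in N).
Qed.

End TT3Free.

Lemma exists_max_outdeg : 0 < #|V| ->
  exists u, forall v, outdeg D v <= outdeg D u.
Proof.
by case/card_gt0P=> u0 _; case: (arg_maxnP (outdeg D) (erefl (predT u0))) => u _ maxu;
  exists u => v; apply: maxu.
Qed.

Lemma TT3_free_sum_le :
  free TT3 D -> sum_outdeg_sq D <= #|V| * (#|V| ^ 2 %/ 4).
Proof.
move=> freeD; have [V0|/exists_max_outdeg [u maxu]] := posnP #|V|.
  by rewrite /sum_outdeg_sq big_pred0 // => v; have := card0_eq V0 v.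
apply: leq_trans (TT3_free_sum_leqif freeD maxu) _.
by rewrite leq_mul2l -[in _ ^ 2](cardsC [set w | adj D u w]) leq_mul_sqr_div4 orbT.
Qed.

Lemma TT3_free_max_complete_cut : 0 < #|V| -> free TT3 D ->
    sum_outdeg_sq D = #|V| * (#|V| ^ 2 %/ 4) ->
  exists2 A, complete_cut A & #|A| = #|V|./2.
Proof.
move=> V_gt0 freeD sumE; have [u maxu] := exists_max_outdeg V_gt0.
pose N := [set w | adj D u w]; have cardN := cardsC N.
have [leD eqD] := TT3_free_sum_leqif freeD maxu.
(* The product is at most the floor by the mean inequality, and at least the floor after cancelling
   the positive factor [#|V|] in [leD]. *)
have mulE : #|N| * #|~: N| = #|V| ^ 2 %/ 4.
  apply/eqP; rewrite eqn_leq -[in X in X && _]cardN leq_mul_sqr_div4 /=.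
  by move: leD; rewrite sumE leq_pmul2l.
have cutN : complete_cut N.
  apply: TT3_free_extremal => // v; apply/eqP.
  by move: v; apply/forallP; rewrite -eqD sumE -mulE.
(* Either [N] or its complement may be the smaller side, and both describe the same cut. *)
rewrite -cardN in mulE *; have [hN|hN] := mul_eq_sqr_div4 mulE; first by exists N.
by exists (~: N) => //; apply: complete_cutC.
Qed.

End Digraph.

Lemma cut_rel_irr (V : finType) (A : {set V}) :
  irreflexive (fun x y => (x \in A) != (y \in A)).
Proof. by move=> x; rewrite eqxx. Qed.

Lemma card_setC_half (V : finType) (A : {set V}) :
  #|A| = #|V|./2 -> #|~: A| = uphalf #|V|.
Proof. by move=> cardA; have := cardsC A; rewrite cardA; lia. Qed.

Theorem theorem5p1 (m : nat) (hm : 1 <= m) :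
  ex2p m TT3 = m * (m ^ 2 %/ 4) /\
  (forall (V : finType) (D : digraph V),
     #|V| = m -> free TT3 D ->
     (sum_outdeg_sq D = m * (m ^ 2 %/ 4) <->
      isomorphic D (complete_bipartite m./2 (uphalf m)))).
Proof.
split.
  apply/eqP; rewrite eqn_leq; apply/andP; split.
    by apply/bigmax_leqP => D /TT3_free_sum_le; rewrite card_ord.
  (* The lower bound is attained on ['I_m] by the balanced cut with side [A]. *)
  have [A cardA] : exists A : {set 'I_m}, #|A| = m./2.
    have : m./2 <= #|[set: 'I_m]| by rewrite cardsT card_ord; lia.
    case/card_geqP=> s [us <- _]; exists [set x in s].
    by rewrite cardsE; apply/card_uniqP.
  pose D := digraph_of_rel (cut_rel_irr A).
  have cutD : complete_cut D A by move=> x y; rewrite /adj inE.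
  have cardAC : #|~: A| = uphalf m by rewrite card_setC_half card_ord.
  rewrite -half_mul_uphalf -{1}cardA -cardAC -{1}(card_ord m).
  rewrite -(sum_outdeg_sq_complete_cut cutD).
  exact/leq_bigmax_cond/complete_cut_free/cutD.
move=> V D cardV freeD; split; rewrite -cardV.
  have V_gt0 : 0 < #|V| by rewrite cardV.
  case/(TT3_free_max_complete_cut V_gt0 freeD)=> A cutA cardA.
  by rewrite -cardA -(card_setC_half cardA); apply: complete_cut_isomorphic.
case/isomorphic_complete_cut=> A [cutA cardA cardAC].
by rewrite (sum_outdeg_sq_complete_cut cutA) cardA cardAC half_mul_uphalf.
Qed.
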